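(* Let $W=W(\Gamma,\mathbf m)$ be a graph product of directly-indecomposable cyclic groups and let $\Omega\subseteq\Gamma$ be a full subgraph. Let $\phi\in\operatorname{Aut}^0W$ and suppose there exist $z_1,\dots,z_N\in W(\Omega)$ such that $\phi(v_j)=z_jv_jz_j^{-1}$ for each $1\le j\le N$. Then for any word in the alphabet $\mathcal P^{\pm1}$ which spells $\phi$, the word in the alphabet $\mathcal P_\Omega^{\pm1}$ obtained from it by omitting all letters not in $\mathcal P_\Omega^{\pm1}$ still spells $\phi$.
   Context: $\Gamma$ is a finite simplicial graph with non-empty vertex set $V=\{v_1,\dots,v_N\}$. An order map is a function $\mathbf m:\{1,\dots,N\}\to\{p^\alpha : p \text{ prime},\ \alpha\ge 1\}\cup\{\infty\}$. The graph product of directly-indecomposable cyclic groups $W=W(\Gamma,\mathbf m)$ is the group with generators $V$ and relations $v_i^{\mathbf m(i)}=1$ (no relation if $\mathbf m(i)=\infty$) and $v_jv_k=v_kv_j$ whenever $v_j,v_k$ are adjacent in $\Gamma$. For a full subgraph $\Omega$, $W(\Omega)$ is the subgroup generated by the vertices of $\Omega$. $\operatorname{Aut}^0 W$ is the group of automorphisms of $W$ which map each vertex $v_i$ to a conjugate of itself. $S_i$ denotes the star of $v_i$ (the full subgraph on the vertices at distance at most $1$ from $v_i$). For $1\le i\le N$ and $K$ a connected component of $\Gamma\setminus S_i$, the partial conjugation $\chi_{iK}$ is the automorphism of $W$ with $\chi_{iK}(v_j)=v_iv_jv_i^{-1}$ if $v_j\in K$ and $\chi_{iK}(v_j)=v_j$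 if $v_j\notin K$. $\mathcal P$ is the set of all partial conjugations (it generates $\operatorname{Aut}^0W$, by a theorem of Laurence) and $\mathcal P_\Omega=\{\chi_{iQ}\in\mathcal P: v_i\in\Omega\}$. *)

(* Defs.v *)
From HB Require Import structures.
From mathcomp Require Import all_boot generic_quotient.
From mathcomp Require Import boolp classical_sets.

Set Implicit Arguments.
Unset Strict Implicit.
Unset Printing Implicit Defensive.

Local Open Scope group_scope.
Local Open Scope classical_set_scope.
Local Open Scope quotient_scope.

(* A finite simplicial graph on the vertex set {v_1, ..., v_N}, indexed here by
   'I_N; a full subgraph is given by its vertex set. *)
Record simple_graph (N : nat) := SimpleGraph {
  adj :> rel 'I_N;
  adj_sym : symmetric adj;
  adj_irr : irreflexive adj }.

Definition prime_power (q : nat) : Prop :=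
  exists p a : nat, [/\ prime p, 0 < a & q = p ^ a]%N.

(* None encodes the value infinity. *)
Record order_map (N : nat) := OrderMap {
  ord :> 'I_N -> option nat;
  ordP : forall i q, ord i = Some q -> prime_power q }.

Section GraphProduct.
Variables (N : nat) (G : simple_graph N) (m : order_map N).

(* Words in the generators and their formal inverses: (i, false) stands for
   v_i and (i, true) for v_i^-1. *)
Local Notation gword := (seq ('I_N * bool)).

(* The congruence on words defining the group presented by
   < v_1, ..., v_N | v_i ^ m(i) (m(i) finite), [v_j, v_k] (j, k adjacent) >. *)
Inductive gp_congr : gword -> gword -> Prop :=
| gp_refl u : gp_congr u u
| gp_sym u v : gp_congr u v -> gp_congr v u
| gp_trans u v w : gp_congr u v -> gp_congr v w -> gp_congr u w
| gp_cat u u' v v' :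
    gp_congr u u' -> gp_congr v v' -> gp_congr (u ++ v) (u' ++ v')
| gp_cancel i b : gp_congr [:: (i, b); (i, ~~ b)] [::]
| gp_order i q : m i = Some q -> gp_congr (nseq q (i, false)) [::]
| gp_comm j k : G j k ->
    gp_congr [:: (j, false); (k, false)] [:: (k, false); (j, false)].

Definition gp_eq : rel gword := fun u v => `[< gp_congr u v >].

Lemma gp_eq_refl : reflexive gp_eq.
Proof. by move=> u; apply/asboolP/gp_refl. Qed.

Lemma gp_eq_sym : symmetric gp_eq.
Proof.
by move=> u v; apply/idP/idP => /asboolP h; apply/asboolP/gp_sym.
Qed.

Lemma gp_eq_trans : transitive gp_eq.
Proof.
by move=> v u w /asboolP h1 /asboolP h2; apply/asboolP/(gp_trans h1 h2).
Qed.

Canonical gp_equiv := EquivRel gp_eq gp_eq_refl gp_eq_sym gp_eq_trans.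

Definition graph_product : Type := {eq_quot gp_eq}.
HB.instance Definition _ := Choice.on graph_product.
HB.instance Definition _ := EqQuotient.on graph_product.

Lemma gp_piP (u v : gword) : gp_congr u v <-> \pi_graph_product u = \pi_graph_product v.
Proof.
by split=> [h | /eqmodP/asboolP //]; apply/eqmodP/asboolP.
Qed.

Lemma gp_repr_pi (u : gword) : gp_congr (repr (\pi_graph_product u)) u.
Proof. by apply/gp_piP; rewrite reprK. Qed.

Definition inv_gword (u : gword) : gword := rev [seq (x.1, ~~ x.2) | x <- u].

Lemma inv_gword_cat u v : inv_gword (u ++ v) = inv_gword v ++ inv_gword u.
Proof. by rewrite /inv_gword map_cat rev_cat. Qed.

Lemma inv_gwordK : involutive inv_gword.
Proof.
move=> u; rewrite /inv_gword map_rev revK -map_comp -[RHS]map_id.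
by apply: eq_map => -[i b] /=; rewrite negbK.
Qed.

Lemma gp_mulV u : gp_congr (u ++ inv_gword u) [::].
Proof.
elim: u => [|[i b] u IH]; first exact: gp_refl.
rewrite -cat1s inv_gword_cat -catA [u ++ _]catA.
apply: gp_trans (gp_cancel i b); rewrite -[[:: _; _]]/([:: (i, b)] ++ _).
apply: gp_cat (gp_refl _) _.
exact: (gp_cat IH (gp_refl (inv_gword [:: (i, b)]))).
Qed.

Lemma gp_Vmul u : gp_congr (inv_gword u ++ u) [::].
Proof. by rewrite -{2}[u]inv_gwordK; exact: gp_mulV. Qed.

Lemma gp_congr_inv u v : gp_congr u v -> gp_congr (inv_gword u) (inv_gword v).
Proof.
move=> h; apply: (@gp_trans _ (inv_gword u ++ (v ++ inv_gword v))).
  rewrite -{1}[inv_gword u]cats0.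
  exact: gp_cat (gp_refl _) (gp_sym (gp_mulV v)).
rewrite catA -[X in gp_congr _ X]cat0s; apply: gp_cat (gp_refl _).
exact: gp_trans (gp_cat (gp_refl _) (gp_sym h)) (gp_Vmul u).
Qed.

Definition gp_mul (x y : graph_product) : graph_product :=
  \pi_graph_product (repr x ++ repr y).
Definition gp_one : graph_product := \pi_graph_product [::].
Definition gp_inv (x : graph_product) : graph_product :=
  \pi_graph_product (inv_gword (repr x)).

Lemma gp_mulE u v :
  gp_mul (\pi_graph_product u) (\pi_graph_product v) = \pi_graph_product (u ++ v).
Proof. by apply/gp_piP/gp_cat; exact: gp_repr_pi. Qed.

Lemma gp_invE u : gp_inv (\pi_graph_product u) = \pi_graph_product (inv_gword u).
Proof. by apply/gp_piP/gp_congr_inv/gp_repr_pi. Qed.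

Lemma gp_mulA : associative gp_mul.
Proof.
move=> x y z; elim/(@quotW _ graph_product): x => u; elim/(@quotW _ graph_product): y => v; elim/(@quotW _ graph_product): z => w.
by rewrite !gp_mulE catA.
Qed.

Lemma gp_mul1 : left_id gp_one gp_mul.
Proof. by move=> x; elim/(@quotW _ graph_product): x => u; rewrite gp_mulE. Qed.

Lemma gp_mulr1 : right_id gp_one gp_mul.
Proof. by move=> x; elim/(@quotW _ graph_product): x => u; rewrite gp_mulE cats0. Qed.

Lemma gp_mulVg : left_inverse gp_one gp_inv gp_mul.
Proof. by move=> x; elim/(@quotW _ graph_product): x => u; rewrite gp_invE gp_mulE; apply/gp_piP/gp_Vmul. Qed.

Lemma gp_mulgV : right_inverse gp_one gp_inv gp_mul.
Proof. by move=> x; elim/(@quotW _ graph_product): x => u; rewrite gp_invE gp_mulE; apply/gp_piP/gp_mulV. Qed.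

HB.instance Definition _ :=
  isGroup.Build graph_product gp_mulA gp_mul1 gp_mulr1 gp_mulVg gp_mulgV.

Definition vertex (i : 'I_N) : graph_product :=
  \pi_graph_product [:: (i, false)].

End GraphProduct.

Definition is_subgroup (H : groupType) (A : set H) : Prop :=
  [/\ A 1, forall x y, A x -> A y -> A (x * y) & forall x, A x -> A x^-1].

Definition subgroup_generated (H : groupType) (A : set H) : set H :=
  smallest (@is_subgroup H) A.

Section Automorphisms.
Variable H : groupType.

Record aut := Aut {
  aut_fun :> H -> H;
  aut_inv : H -> H;
  autM : {morph aut_fun : x y / x * y};
  aut_funK : cancel aut_fun aut_inv;
  aut_invK : cancel aut_inv aut_fun }.

Lemma aut_eqP (f g : aut) : f =1 g -> f = g.
Proof.
case: f g => [f f' fM fK f'K] [g g' gM gK g'K] /= /funext efg.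
have efg' : f' = g' by apply/funext => x; rewrite -{1}[x]g'K -efg fK.
by case: _ / efg in gM gK g'K *; case: _ / efg' in gK g'K *; congr Aut;
  exact: Prop_irrelevance.
Qed.

HB.instance Definition _ := gen_eqMixin aut.
HB.instance Definition _ := gen_choiceMixin aut.

Lemma aut_mul_subproof (f g : aut) : {morph f \o g : x y / x * y}.
Proof. by move=> x y /=; rewrite !autM. Qed.

(* Products of automorphisms are composed from right to left. *)
Definition aut_mul (f g : aut) : aut :=
  Aut (@aut_mul_subproof f g)
      (can_comp (aut_funK f) (aut_funK g))
      (can_comp (aut_invK g) (aut_invK f)).

Lemma aut_one_subproof : {morph @id H : x y / x * y}.
Proof. by []. Qed.

Definition aut_one : aut :=
  @Aut id id aut_one_subproof (fun=> erefl) (fun=> erefl).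

Lemma aut_inv_subproof (f : aut) : {morph aut_inv f : x y / x * y}.
Proof.
by move=> x y; apply: (can_inj (aut_funK f)); rewrite autM !aut_invK.
Qed.

Definition aut_invg (f : aut) : aut :=
  Aut (@aut_inv_subproof f) (aut_invK f) (aut_funK f).

Lemma aut_mulA : associative aut_mul.
Proof. by move=> f g h; apply: aut_eqP. Qed.

Lemma aut_mul1 : left_id aut_one aut_mul.
Proof. by move=> f; apply: aut_eqP. Qed.

Lemma aut_mulr1 : right_id aut_one aut_mul.
Proof. by move=> f; apply: aut_eqP. Qed.

Lemma aut_mulVg : left_inverse aut_one aut_invg aut_mul.
Proof. by move=> f; apply: aut_eqP => x; exact: aut_funK. Qed.

Lemma aut_mulgV : right_inverse aut_one aut_invg aut_mul.
Proof. by move=> f; apply: aut_eqP => x; exact: aut_invK. Qed.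

HB.instance Definition _ :=
  isGroup.Build aut aut_mulA aut_mul1 aut_mulr1 aut_mulVg aut_mulgV.

(* The alphabet S^{+1,-1}. *)
Definition pm (S : set aut) : set aut := [set f | S f \/ S f^-1].

End Automorphisms.

Section PartialConjugations.
Variables (N : nat) (G : simple_graph N) (m : order_map N).
Local Notation W := (graph_product G m).
Local Notation v := (vertex G m).

Definition special_subgroup (Omega : {set 'I_N}) : set W :=
  subgroup_generated [set v i | i in [set` Omega]].

Definition Aut0 : set (aut W) :=
  [set f | forall i, exists g : W, f (v i) = g * v i * g^-1].

Definition star (i : 'I_N) : {set 'I_N} := [set j | (j == i) || G i j]%SET.

Definition full_subgraph (U : {set 'I_N}) : rel 'I_N :=
  [rel j k | [&& j \in U, k \in U & G j k]].

Definition is_component (U K : {set 'I_N}) : Prop :=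
  exists2 k, k \in U &
    K = [set j in U | connect (full_subgraph U) k j]%SET.

Definition is_partial_conjugation (i : 'I_N) (K : {set 'I_N}) (f : aut W)
    : Prop :=
  is_component (~: star i) K /\
  forall j, f (v j) = if j \in K then v i * v j * (v i)^-1 else v j.

Definition partial_conjugations : set (aut W) :=
  [set f | exists i K, is_partial_conjugation i K f].

Definition partial_conjugations_in (Omega : {set 'I_N}) : set (aut W) :=
  [set f | exists i K, i \in Omega /\ is_partial_conjugation i K f].

End PartialConjugations.

Arguments special_subgroup {N} G m Omega.
Arguments Aut0 {N} G m.
Arguments is_partial_conjugation {N} G m i K f.
Arguments partial_conjugations {N} G m.
Arguments partial_conjugations_in {N} G m Omega.

(* Main.v *)
(* Let r : W -> W(Omega) be the retraction killing the vertices outside Omega.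
   An automorphism v_j |-> y_j v_j y_j^-1 is projected to
   v_j |-> r(y_j) v_j r(y_j)^-1; this is compatible with composition and
   inversion, fixes the letters in P_Omega and kills the other partial
   conjugations.  Hence the shortened word spells a projection of phi, and phi is
   a projection of itself as r(z_j) = z_j.  Two projections of phi agree as soon
   as r maps the centraliser of v_j into itself.  For v_j outside Omega this is
   read off an action of W on W * Z/q: the vertices other than v_j act through r
   by left translation of the first factor, and v_j shifts (x, t) to (x, t + 1)
   when x commutes with v_j and fixes it otherwise. *)
Require Import Defs.
From mathcomp Require Import all_boot ssralg zmodp.
From mathcomp Require Import boolp classical_sets.

Local Open Scope group_scope.
Local Open Scope classical_set_scope.

Section Retraction.
Context {N : nat} {G : simple_graph N} {m : order_map N}.
Local Notation W := (graph_product G m).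
Local Notation v := (vertex G m).
Local Notation gword := (seq ('I_N * bool)).
Local Notation pi := (\pi_(graph_product G m)%qT : gword -> W).

Lemma pi_cat (u u' : gword) : pi (u ++ u') = pi u * pi u'.
Proof. exact/esym/gp_mulE. Qed.

Lemma pi_inv (u : gword) : pi (inv_gword u) = (pi u)^-1.
Proof. exact/esym/gp_invE. Qed.

Lemma pi_nil : pi [::] = 1.
Proof. by []. Qed.

Lemma piP (x : W) : exists u, x = pi u.
Proof. by exists (repr x); rewrite generic_quotient.reprK. Qed.

Lemma vertex_ind (P : set W) :
  is_subgroup P -> (forall i, P (v i)) -> forall x, P x.
Proof.
move=> [P1 PM PV] Pv x; have [u ->] := piP x.
elim: u => [|[i b] u IH]; first by rewrite pi_nil.
rewrite -cat1s pi_cat; apply: PM IH; case: b; last exact: Pv.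
by rewrite -[[:: _]]/(inv_gword [:: (i, false)]) pi_inv; apply/PV/Pv.
Qed.

Lemma vertex_commute (i j : 'I_N) : G i j -> v i * v j = v j * v i.
Proof. by move=> Gij; rewrite -!pi_cat; apply/gp_piP/gp_comm. Qed.

(** * The retraction of W onto W(Omega) *)

Variable Omega : {set 'I_N}.

Definition restrict (u : gword) : gword := [seq x <- u | x.1 \in Omega].

(** Deleting the letters outside [Omega] turns each defining relation into itself or into an
    identity between equal words. *)
Lemma gp_congr_restrict (u u' : gword) :
  gp_congr G m u u' -> gp_congr G m (restrict u) (restrict u').
Proof.
elim=> {u u'}.
- by move=> u; exact: gp_refl.
- by move=> u u' _; exact: gp_sym.
- by move=> u u' u'' _ + _; exact: gp_trans.
- by move=> u u' w w' _ IHu _ IHw; rewrite /restrict !filter_cat; exact: gp_cat.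
- move=> i b; rewrite /restrict /=.
  by case: (i \in Omega); [exact: gp_cancel | exact: gp_refl].
- move=> i q mi; rewrite /restrict filter_nseq /=.
  by case: (i \in Omega); [rewrite mul1n; exact: gp_order | exact: gp_refl].
- move=> j k Gjk; rewrite /restrict /=.
  by case: (j \in Omega); case: (k \in Omega); by [exact: gp_comm | exact: gp_refl].
Qed.

Definition retract (x : W) : W := pi (restrict (repr x)).
Local Notation r := retract.

Lemma retract_pi (u : gword) : r (pi u) = pi (restrict u).
Proof. by apply/gp_piP/gp_congr_restrict/gp_repr_pi. Qed.

Lemma retractM : {morph r : x y / x * y}.
Proof.
move=> x y; have [u ->] := piP x; have [u' ->] := piP y.
by rewrite -pi_cat !retract_pi -pi_cat /restrict filter_cat.
Qed.

Lemma retract1 : r 1 = 1.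
Proof. by rewrite -pi_nil retract_pi. Qed.

Lemma retractV : {morph r : x / x^-1}.
Proof. by move=> x; apply: (mulgI (r x)); rewrite -retractM !mulgV retract1. Qed.

Lemma retract_vertex (i : 'I_N) : r (v i) = if i \in Omega then v i else 1.
Proof. by rewrite retract_pi /restrict /=; case: ifP. Qed.

Lemma retract_special (x : W) : special_subgroup G m Omega x -> r x = x.
Proof.
move=> /(_ [set y | r y = y]) /=; apply; split.
  split=> /= [|y z ry rz|y ry]; first exact: retract1.
    by rewrite retractM ry rz.
  by rewrite retractV ry.
by move=> _ [i iO <-] /=; rewrite retract_vertex; move: iO => /= ->.
Qed.

(** * The action on W * Z/q, and centralisers under the retraction *)

Section Shift.
Variable j : 'I_N.
(** If v_j has infinite order, no relation bounds the shift, and any modulus above 1 would serve;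
    the default is 2. *)
Local Notation q := (odflt 2 (m j)).
Local Notation X := (W * 'Z_q)%type.

Let commutes (x : W) : bool := `[< x * v j = v j * x >].

Definition shift_letter (a : 'I_N * bool) (p : X) : X :=
  if a.1 == j then
    if commutes p.1 then (p.1, p.2 + (if a.2 then - 1 else 1))%R else p
  else (r (pi [:: a]) * p.1, p.2).

Definition shift (u : gword) (p : X) : X := foldr shift_letter p u.

Lemma shift_cat (u u' : gword) (p : X) : shift (u ++ u') p = shift u (shift u' p).
Proof. by rewrite /shift foldr_cat. Qed.

(** For n at most 1 the type ['Z_n] is Z/2, so the bound is what gives ['Z_q] characteristic q. *)
Lemma order_gt1 : 1 < q.
Proof.
case E: (m j) => [k|] //=.
have [p [a [p_pr a0 ->]]] := ordP E.
by rewrite -(exp1n a) ltn_exp2r // prime_gt1.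
Qed.

(** The factor [r (v i)] is v_i or 1, hence lies in the centraliser of v_j. This makes v_j and its
    neighbours act by commuting maps. *)
Lemma commutes_retract_link (i : 'I_N) (x : W) :
  G i j -> commutes (r (v i) * x) = commutes x.
Proof.
move=> Gij; rewrite retract_vertex; case: ifP => _; last by rewrite mul1g.
apply/asboolP/asboolP => [|vx].
  by rewrite mulgA -vertex_commute // -!mulgA => /mulgI.
by rewrite mulgA -vertex_commute // -!mulgA vx.
Qed.

Lemma shift_congr (u u' : gword) : gp_congr G m u u' -> shift u =1 shift u'.
Proof.
elim=> {u u'} //.
- by move=> u u' _ IH p.
- by move=> u u' u'' _ IH _ IH' p; rewrite IH.
- by move=> u u' w w' _ IHu _ IHw p; rewrite !shift_cat IHw IHu.
- move=> i b [x t]; rewrite /shift /= /shift_letter /=.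
  (* The letters of v_j leave the first coordinate alone, so both make the same test and their
     shifts cancel. *)
  case: eqP => _ /=.
    case cx: (commutes x) => /=; rewrite cx //.
    by case: b => /=; rewrite -GRing.addrA ?GRing.addNr ?GRing.subrr GRing.addr0.
  rewrite mulgA -retractM -pi_cat.
  by rewrite ((gp_piP G m _ _).1 (gp_cancel G m i b)) pi_nil retract1 mul1g.
- move=> i k mi [x t].
  case: (eqVneq i j) => [ij | ij].
    have shiftE n : shift (nseq n (i, false)) (x, t)
        = (if commutes x then (x, t + n%:R) else (x, t))%R.
      elim: n => [|n IH]; first by rewrite /= GRing.addr0; case: ifP.
      rewrite [LHS]/= -/(shift _ _) IH /shift_letter /= ij eqxx.
      by case cx: (commutes x) => /=; rewrite cx // -GRing.addrA GRing.natr1.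
    rewrite shiftE; have -> : (k%:R = 0 :> 'Z_q)%R.
      by rewrite -(char_Zp order_gt1) -ij mi.
    by rewrite GRing.addr0; case: ifP.
  have shiftE n : shift (nseq n (i, false)) (x, t)
      = (r (pi (nseq n (i, false))) * x, t).
    elim: n => [|n IH]; first by rewrite pi_nil retract1 mul1g.
    rewrite [LHS]/= -/(shift _ _) IH /shift_letter /= (negbTE ij).
    by rewrite mulgA -retractM -pi_cat.
  by rewrite shiftE ((gp_piP G m _ _).1 (gp_order G mi)) pi_nil retract1 mul1g.
- move=> i k Gik [x t]; rewrite /shift /= /shift_letter /=.
  case: (eqVneq i j) => [ij | ij]; case: (eqVneq k j) => [kj | kj] //=.
  + rewrite commutes_retract_link; last by rewrite adj_sym -ij.
    by case: ifP.
  + rewrite commutes_retract_link; last by rewrite -kj.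
    by case: ifP.
  + by rewrite !mulgA -!retractM -!/(v _) vertex_commute.
Qed.

(** Letters of v_j fix the first coordinate, which agrees with translation by [r (v j)] exactly
    because r kills v_j. *)
Lemma shift_fst (u : gword) (p : X) :
  j \notin Omega -> (shift u p).1 = r (pi u) * p.1.
Proof.
move=> jO; elim: u => [|[i b] u IH]; first by rewrite pi_nil retract1 mul1g.
rewrite -cat1s pi_cat retractM -mulgA -IH shift_cat; move: (shift u p) => {p IH} p.
rewrite /shift /= /shift_letter /=; case: eqP => //= ->.
by rewrite retract_pi /restrict /= (negbTE jO) pi_nil mul1g; case: ifP.
Qed.

Lemma shift_inj (u : gword) : injective (shift u).
Proof.
apply: (can_inj (g := shift (inv_gword u))) => p.
by rewrite -shift_cat (shift_congr _ _ (gp_Vmul G m u)).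
Qed.

Lemma retract_centraliser (c : W) :
  c * v j = v j * c -> r c * v j = v j * r c.
Proof.
have [jO | jO] := boolP (j \in Omega).
  by move=> /(congr1 r); rewrite !retractM retract_vertex jO.
have [u ->] := piP c => cv.
apply/asboolP; rewrite -/(commutes _); apply: contraT => ncomm.
have /shift_congr/(_ (1, 0%R)) :
    gp_congr G m (u ++ [:: (j, false)]) ([:: (j, false)] ++ u).
  by apply/gp_piP; rewrite !pi_cat.
(* On the right v_j acts last, at first coordinate r(c), and does nothing; on the left it acts first
   and sends (1, 0) to (1, 1). So c has the same value at (1, 1) and (1, 0), which forces 1 = 0 in
   Z/q. *)
rewrite !shift_cat [RHS]/= /shift_letter eqxx shift_fst //= mulg1 (negbTE ncomm).
have c1 : commutes 1 by apply/asboolP; rewrite mulg1 mul1g.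
rewrite /shift_letter eqxx c1.
move=> /shift_inj/(congr1 snd) e01; have /eqP : (0 + 1 = 0 :> 'Z_q)%R by exact: e01.
by rewrite GRing.add0r GRing.oner_eq0.
Qed.

End Shift.

(** * Projections of automorphisms *)

(** A relation rather than a function, as f determines [y j] only up to right multiplication by the
    centraliser of v_j. *)
Definition projects (f f' : aut W) : Prop :=
  exists y : 'I_N -> W, forall j,
    f (v j) = y j * v j * (y j)^-1 /\ f' (v j) = r (y j) * v j * (r (y j))^-1.

Lemma aut1 (f : aut W) : f 1 = 1.
Proof. by apply: (mulgI (f 1)); rewrite -autM !mulg1. Qed.

Lemma autV (f : aut W) : {morph f : x / x^-1}.
Proof. by move=> x; apply: (mulgI (f x)); rewrite -autM !mulgV aut1. Qed.

Lemma aut_vertexP (f g : aut W) : (forall i, f (v i) = g (v i)) -> f = g.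
Proof.
move=> fg; apply: aut_eqP; apply: (vertex_ind [set x | f x = g x]) => //.
split=> /= [|x y fx fy|x fx]; first by rewrite !aut1.
  by rewrite !autM fx fy.
by rewrite !autV fx.
Qed.

(** Both sides are morphisms in x, so generators suffice; for v_i outside [Omega] both are 1, since
    r kills every conjugate of v_i. *)
Lemma retract_projects (f f' : aut W) :
  projects f f' -> forall x, r (f x) = f' (r x).
Proof.
move=> [y fy]; apply: (vertex_ind [set x | r (f x) = f' (r x)]) => [|i] /=.
  split=> /= [|x z fx fz|x fx]; first by rewrite aut1 retract1 aut1.
    by rewrite autM !retractM autM fx fz.
  by rewrite autV !retractV autV fx.
have [-> f'v] := fy i.
rewrite !retractM retractV retract_vertex; case: ifP => _; first by rewrite f'v.
by rewrite aut1 mulg1 mulgV.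
Qed.

Lemma projects1 : projects 1 1.
Proof. by exists (fun=> 1) => j; rewrite retract1 !mul1g invg1 mulg1. Qed.

Lemma projectsM (f f' g g' : aut W) :
  projects f f' -> projects g g' -> projects (f * g) (f' * g').
Proof.
move=> pf [z gz]; have rf := retract_projects _ _ pf; have [y fy] := pf.
exists (fun j => f (z j) * y j) => j; have [gv g'v] := gz j; have [fv f'v] := fy j.
rewrite -[(f * g) _]/(f (g _)) -[(f' * g') _]/(f' (g' _)) gv g'v !autM !autV fv f'v.
by rewrite retractM rf !invgM !mulgA.
Qed.

Lemma projectsV (f f' : aut W) : projects f f' -> projects f^-1 f'^-1.
Proof.
move=> pf; have rf := retract_projects _ _ pf; have [y fy] := pf.
have fK (h : aut W) x : h (h^-1 x) = x by exact: aut_invK.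
have Kf (h : aut W) x : h^-1 (h x) = x by exact: aut_funK.
(* Apply f^-1 to f(v_j) = y_j v_j y_j^-1 and solve for f^-1(v_j). *)
exists (fun j => (f^-1 (y j))^-1) => j; have [fv f'v] := fy j.
rewrite !retractV !invgK; split.
  apply: (can_inj (aut_funK f)).
  by rewrite fK !autM autV fK fv !mulgA mulVg mul1g mulgVK.
apply: (can_inj (aut_funK f')).
by rewrite fK !autM autV -rf fK f'v !mulgA mulVg mul1g mulgVK.
Qed.

Lemma projects_partial_conjugation (i : 'I_N) (K : {set 'I_N}) (f : aut W) :
  is_partial_conjugation G m i K f -> projects f (if i \in Omega then f else 1).
Proof.
move=> [_ fv]; exists (fun j => if j \in K then v i else 1) => j.
rewrite fv; split; first by case: ifP => _ //; rewrite mul1g invg1 mulg1.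
case: (boolP (j \in K)) => jK; last first.
  by rewrite retract1 mul1g invg1 mulg1; case: ifP; rewrite // fv (negbTE jK).
rewrite retract_vertex; case: ifP => _; first by rewrite fv jK.
by rewrite mul1g invg1 mulg1.
Qed.

Lemma projects_letter (l : aut W) :
  pm (partial_conjugations G m) l ->
  projects l (if l \in pm (partial_conjugations_in G m Omega) then l else 1).
Proof.
case: ifPn => [/set_mem [] [i [K [iO]]] /projects_partial_conjugation | lO].
- by rewrite iO.
- by move=> /projectsV; rewrite iO invgK.
(* The filter tests the automorphism [l], not a chosen index: once it fails, every way of writing
   [l] as a partial conjugation or the inverse of one has its vertex outside [Omega]. *)
have notin i K : is_partial_conjugation G m i K l
    \/ is_partial_conjugation G m i K l^-1 -> i \in Omega = false.
  move=> h; apply: contraNF lO => iO; apply/mem_set.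
  by case: h => h; [left | right]; exists i, K.
case=> [] [i [K lK]]; have /projects_partial_conjugation := lK.
  by rewrite (notin i K) //; left.
by rewrite (notin i K); [move=> /projectsV; rewrite invgK invg1 | right].
Qed.

(** Two conjugators y_j and z_j for f(v_j) differ by d = z_j^-1 y_j in the centraliser of v_j, and
    r(d) stays there. *)
Lemma projects_uniq (f f1 f2 : aut W) :
  projects f f1 -> projects f f2 -> f1 = f2.
Proof.
move=> [y fy] [z fz]; apply: aut_vertexP => j.
have [fyj ->] := fy j; have [fzj ->] := fz j.
have /retract_centraliser : ((z j)^-1 * y j) * v j = v j * ((z j)^-1 * y j).
  apply: (mulgI (z j)); apply: (mulIg (y j)^-1).
  by rewrite !mulgA mulgV mul1g -fyj fzj mulgK.
have {1 2}-> : r (y j) = r (z j) * r ((z j)^-1 * y j).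
  by rewrite retractM retractV mulgA mulgV mul1g.
by move: (r (_ * _)) => d dv; rewrite -[_ * _ * v j]mulgA dv invgM !mulgA mulgK.
Qed.

End Retraction.

Theorem corollary1p6 (N : nat) (N_gt0 : (0 < N)%N) (G : simple_graph N)
    (m : order_map N) (Omega : {set 'I_N}) (phi : aut (graph_product G m))
    (phi_Aut0 : Aut0 G m phi)
    (phi_Omega : exists z : 'I_N -> graph_product G m,
       forall j, special_subgroup G m Omega (z j) /\
         phi (vertex G m j) = z j * vertex G m j * (z j)^-1)
    (w : seq (aut (graph_product G m)))
    (w_alphabet : forall l, l \in w -> pm (partial_conjugations G m) l)
    (w_spells : \prod_(l <- w) l = phi) :
  \prod_(l <- [seq l <- w | l \in pm (partial_conjugations_in G m Omega)]) l
  = phi.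
Proof.
have phi_self : projects Omega phi phi.
  have [z zP] := phi_Omega; exists z => j; have [zO phiv] := zP j.
  by rewrite retract_special.
apply: projects_uniq phi_self; rewrite -w_spells big_filter.
(* Omitted letters become factors 1, so the two products can be compared letter by letter. *)
rewrite [X in projects _ _ X]big_mkcond /=.
elim: w w_alphabet {w_spells} => [|l w IH] wP.
  by rewrite !big_nil; exact: projects1.
rewrite !big_cons; apply: projectsM.
  exact/projects_letter/wP/mem_head.
by apply: IH => l' l'w; apply: wP; rewrite in_cons l'w orbT.
Qed.
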